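(* Let $p$ be an odd prime, let $n,m$ be positive integers, and let $G_1$ and $G_2$ be connected graphs of orders $np$ and $m$, respectively. Let $g_1:V(G_1)\to\{1,2,\ldots,np\}$ and $g_2:V(G_2)\to\{1,2,\ldots,m\}$ be bijections, and for $i=1,2$ put $$\varrho_i=\{ab\in E(G_i):([g_i(a)+g_i(b)]/p)=1\},$$ $$\eta_i=\{ab\in E(G_i):([g_i(a)+g_i(b)]/p)=-1\text{ or }g_i(a)+g_i(b)\equiv 0\pmod p\}.$$ If $$|\varrho_1|+|\varrho_2|=|\eta_1|+|\eta_2|+nm\pm 1\quad\text{(either sign)}$$ or $$|\varrho_1|+|\varrho_2|=|\eta_1|+|\eta_2|+nm,$$ then the join graph $G_1+G_2$ is a Legendre cordial graph modulo $p$.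
   Context: All graphs are finite, simple, and connected. The order of a graph is its number of vertices. Join: for graphs $G_1,G_2$ (with disjoint vertex sets), $G_1+G_2$ has vertex set $V(G_1)\cup V(G_2)$ and edge set $E(G_1)\cup E(G_2)\cup\{uv:u\in V(G_1)\text{ and }v\in V(G_2)\}$. Legendre symbol: for an odd prime $p$ and an integer $a$ relatively prime to $p$, $(a/p)=1$ if $x^2\equiv a\pmod p$ has a solution and $(a/p)=-1$ otherwise. Legendre cordial labeling: let $p$ be an odd prime and $H$ a simple connected graph of order $N$. A bijection $f:V(H)\to\{1,2,\ldots,N\}$ is a Legendre cordial labeling modulo $p$ if the induced function $f_p^*:E(H)\to\{0,1\}$, defined by $f_p^*(uv)=0$ if $([f(u)+f(v)]/p)=-1$ or $f(u)+f(v)\equiv 0\pmod p$, and $f_p^*(uv)=1$ if $([f(u)+f(v)]/p)=1$, satisfies $|e_{f_p^*}(0)-e_{f_p^*}(1)|\leq 1$, where $e_{f_p^*}(i)$ is the number of edges with label $i$ ($i=0,1$). A graph admitting such a labeling is called a Legendre cordial graph modulo $p$. *)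

(* Defs.v *)
From HB Require Import structures.
From mathcomp Require Import all_boot all_order all_algebra.

Set Implicit Arguments.
Unset Strict Implicit.
Unset Printing Implicit Defensive.

Import Order.TTheory GRing.Theory Num.Theory.

Record sgraph := SGraph {
  vertex :> finType;
  adj : rel vertex;
  adj_sym : symmetric adj;
  adj_irrefl : irreflexive adj }.

Definition graph_order (G : sgraph) : nat := #|G|.

Definition connected_graph (G : sgraph) : Prop :=
  0 < graph_order G /\ forall x y : G, connect (@adj G) x y.

Section Join.
Variables G1 G2 : sgraph.

Definition join_adj (x y : G1 + G2) : bool :=
  match x, y with
  | inl a, inl b => adj a b
  | inr a, inr b => adj a b
  | _, _ => true
  end.

Lemma join_adj_sym : symmetric join_adj.
Proof. by move=> [a|a] [b|b] //=; apply: adj_sym. Qed.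

Lemma join_adj_irrefl : irreflexive join_adj.
Proof. by move=> [a|a] /=; apply: adj_irrefl. Qed.

Definition join_graph : sgraph := SGraph join_adj_sym join_adj_irrefl.
End Join.

(* f is a bijection from T onto {1, ..., N}. *)
Definition bij_onto_1N (T : finType) (N : nat) (f : T -> nat) : Prop :=
  injective f /\ forall k : nat, 1 <= k <= N <-> exists x : T, f x = k.

(* The value 0 when p divides a is the usual convention; only the values
   1 and -1 are ever tested below.  The witness of solvability ranges over the
   residues 0, ..., p - 1; see legendre_eq1 for the version over int. *)
Definition legendre (a : int) (p : nat) : int :=
  if (p %| a)%Z then 0%Z
  else if [exists x : 'I_p, (Posz x ^+ 2 == a %[mod p])%Z]%R then 1%Z
  else (-1)%Z.

Lemma legendre_eq1 (a : int) (p : nat) : 0 < p -> ~~ (p %| a)%Z ->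
  legendre a p = 1%Z <-> exists x : int, ((x ^+ 2)%R = a %[mod p])%Z.
Proof.
move=> p_gt0 pNa; rewrite /legendre (negPf pNa); split.
  by case: existsP => // -[x /eqP xa] _; exists (Posz x).
move=> [x xa]; case: existsP => // -[].
have pz : (Posz p != 0)%R by rewrite eqz_nat -lt0n.
have r_ge0 : (0 <= (x %% p)%Z)%R by rewrite modz_ge0.
have r_lt : `|(x %% p)%Z|%N < p.
  by rewrite -ltz_nat gez0_abs // ltz_pmod.
exists (Ordinal r_lt) => /=.
by rewrite gez0_abs // modzXm xa.
Qed.

Definition rho_edges (p : nat) (G : sgraph) (g : G -> nat) : {set {set G}} :=
  [set [set a; b] | a in G, b in G &
    adj a b && (legendre (Posz (g a + g b)) p == 1%Z)].

Definition eta_edges (p : nat) (G : sgraph) (g : G -> nat) : {set {set G}} :=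
  [set [set a; b] | a in G, b in G &
    adj a b && ((legendre (Posz (g a + g b)) p == (-1)%Z)
                || (g a + g b == 0 %[mod p]))].

(* The label of the edge uv, as a symmetric function of its endpoints. *)
Definition induced_label (p : nat) (T : Type) (f : T -> nat) (u v : T) : nat :=
  if (legendre (Posz (f u + f v)) p == (-1)%Z) || (f u + f v == 0 %[mod p])
  then 0 else 1.

(* Edges are unordered pairs {u, v}, so each one is counted once. *)
Definition edges_labelled (p : nat) (G : sgraph) (f : G -> nat) (i : nat) :
    {set {set G}} :=
  [set [set u; v] | u in G, v in G & adj u v && (induced_label p f u v == i)].

Definition legendre_cordial_labeling (p : nat) (H : sgraph) (f : H -> nat) :
    Prop :=
  bij_onto_1N (graph_order H) f /\
  (`| #|edges_labelled p f 0|%:Z - #|edges_labelled p f 1|%:Z | <= 1)%R.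

Definition legendre_cordial_graph (p : nat) (H : sgraph) : Prop :=
  connected_graph H /\
  exists f : H -> nat, legendre_cordial_labeling p f.

(* Main.v *)
Require Import Defs.
From HB Require Import structures.
From mathcomp Require Import all_boot all_order all_algebra.
From mathcomp Require Import zify.

Set Implicit Arguments.
Unset Strict Implicit.
Unset Printing Implicit Defensive.

Import Order.TTheory GRing.Theory Num.Theory.

(** Label [G1] by [g1], which uses the labels [1..np], and [G2] by
    [g2 + np].  Every sum of two labels inside [G1] is unchanged, and every sum
    inside [G2] moves by [2np], a multiple of [p]; so the edges of [G1] and of
    [G2] keep the labels that [g1] and [g2] give them.

    It remains to count the edges between the two sides.  Fix a vertex [b] of
    [G2].  As [a] runs over [G1], the sums of the labels of [a] and [b] run over
    [np] consecutive integers, that is, over [n] complete residue systems modulo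
    [p].  Each system contains exactly [(p - 1)/2] nonzero quadratic residues
    ([sum_qres]) and [(p + 1)/2] other classes, zero included.  Hence [b] sees
    [n] more edges of label 0 than of label 1, and all the cross edges together
    have an excess of [nm] edges of label 0, whatever [g1] and [g2] are.  The
    difference between the numbers of edges of label 1 and 0 is therefore
    [|rho_1| + |rho_2| - |eta_1| - |eta_2| - nm], which the hypothesis bounds by
    1 in absolute value.

    The two halves of the argument are [card_edges_where_join], which splits the
    edges of a join, and [sum_qres_shift], which counts residues along a
    complete set of labels. *)

(** * Edges of a join *)

(** The edge sets of both the hypothesis and the conclusion have this form. *)
Definition edges_where (G : sgraph) (P : rel G) : {set {set G}} :=
  [set [set u; v] | u in G, v in G & adj u v && P u v].

Lemma mem_edges_where (G : sgraph) (P : rel G) (u v : G) :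
  adj u v -> P u v -> [set u; v] \in edges_where P.
Proof.
by move=> uv Puv; apply/imset2P; exists u v => //; rewrite inE /= uv Puv.
Qed.

Lemma edges_whereP (G : sgraph) (P : rel G) (e : {set G}) :
  e \in edges_where P ->
  exists u v : G, [/\ adj u v, P u v & e = [set u; v]].
Proof.
by case/imset2P=> u v _; rewrite inE => /= /andP[uv Puv] ->; exists u, v.
Qed.

Lemma eq_edges_where (G : sgraph) (P Q : rel G) :
  P =2 Q -> edges_where P = edges_where Q.
Proof.
move=> eqPQ; apply/setP => e; apply/idP/idP => /edges_whereP [u [v [uv Puv ->]]];
  by apply: mem_edges_where; rewrite // ?eqPQ // -eqPQ.
Qed.

(** An edge of the join lies inside [G1], inside [G2], or is a cross edge
    [{inl a, inr b}], and a cross edge determines the pair [(a, b)].  Symmetry of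
    [P] is needed because such an edge may be presented from either end. *)
Lemma card_edges_where_join (G1 G2 : sgraph) (P : rel (join_graph G1 G2)) :
  symmetric P ->
  #|edges_where P| =
    #|edges_where (fun a b : G1 => P (inl a) (inl b))|
    + #|edges_where (fun a b : G2 => P (inr a) (inr b))|
    + \sum_(b : G2) \sum_(a : G1) P (inl a) (inr b).
Proof.
move=> symP.
set E1 := edges_where (fun a b : G1 => _); set E2 := edges_where (fun a b : G2 => _).
pose iL := [set (inl @: (e : {set G1}) : {set join_graph G1 G2}) | e in E1].
pose iR := [set (inr @: (e : {set G2}) : {set join_graph G1 G2}) | e in E2].
pose C := [set c : G2 * G1 | P (inl c.2) (inr c.1)].
pose h (c : G2 * G1) : {set join_graph G1 G2} := [set inl c.2; inr c.1].
have h_inj : injective h.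
  move=> [b a] [b' a'] /setP eqh; have := eqh (inl a); have := eqh (inr b).
  by rewrite !inE !eqxx /= !orbF -!sum_eqE /= => /esym/eqP -> /esym/eqP ->.
have iLN e y : e \in iL -> inr y \notin e.
  by case/imsetP=> e' _ ->; apply/imsetP => -[].
have iRN e x : e \in iR -> inl x \notin e.
  by case/imsetP=> e' _ ->; apply/imsetP => -[].
have imL (a b : G1) : inl @: [set a; b] = [set inl a; inl b] :> {set join_graph G1 G2}.
  by rewrite imsetU1 imset_set1.
have imR (a b : G2) : inr @: [set a; b] = [set inr a; inr b] :> {set join_graph G1 G2}.
  by rewrite imsetU1 imset_set1.
have EE : edges_where P = iL :|: iR :|: h @: C.
  apply/setP => e; rewrite !inE; apply/idP/idP.
    case/edges_whereP => -[a|a] [[b|b] [/= ab Pab ->]].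
    - by rewrite -imL imset_f // mem_edges_where.
    - apply/orP; right; apply/imsetP; exists (b, a) => //; by rewrite inE.
    - apply/orP; right; apply/imsetP; exists (a, b); last by rewrite /h setUC.
      by rewrite inE symP.
    - by rewrite -imR [X in _ || X || _]imset_f ?orbT // mem_edges_where.
  case/orP => [/orP[]|] /imsetP.
  - case=> e' /edges_whereP [a [b [ab Pab ->]]] ->.
    by rewrite imL mem_edges_where.
  - case=> e' /edges_whereP [a [b [ab Pab ->]]] ->.
    by rewrite imR mem_edges_where.
  - case=> -[b a]; rewrite inE => /= Pab ->.
    exact: (@mem_edges_where (join_graph G1 G2) P (inl a) (inr b)).
have e2 (e : {set join_graph G1 G2}) : e \in iL -> e \in iR -> False.
  move=> eL eR; case/imsetP: (eL) => e' /edges_whereP[a [b [_ _ ->]]] ee.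
  by have := iRN e a eR; rewrite ee imset_f // set21.
have dis1 : iL :&: iR = set0.
  by apply/setP => e; rewrite !inE; apply/negP => /andP[]; apply: e2.
have dis2 : (iL :|: iR) :&: h @: C = set0.
  apply/setP => e; rewrite !inE; apply/negP => /andP[/orP[/iLN|/iRN] ne];
    case/imsetP => -[b a] _ ee; [have := ne b | have := ne a];
    by rewrite ee !inE eqxx ?orbT.
rewrite EE !cardsU dis1 dis2 cards0 !subn0 (card_imset _ h_inj).
rewrite !card_imset; try exact: imset_inj inr_inj; try exact: imset_inj inl_inj.
congr (_ + _); rewrite -sum1_card pair_bigA /= big_mkcond /=.
by apply: eq_bigr => -[b a] _; rewrite inE /=; case: (P _ _).
Qed.

(** Two vertices on the same side are joined through any vertex of the other
    side. *)
Lemma connected_join (G1 G2 : sgraph) :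
  0 < graph_order G1 -> 0 < graph_order G2 ->
  connected_graph (join_graph G1 G2).
Proof.
rewrite /graph_order => /card_gt0P[a0 _] /card_gt0P[b0 _]; split.
  by apply/card_gt0P; exists (inl a0).
have LR a b : connect (@adj (join_graph G1 G2)) (inl a) (inr b) by exact: connect1.
have RL a b : connect (@adj (join_graph G1 G2)) (inr b) (inl a) by exact: connect1.
move=> [a|b] [a'|b'] //; first exact: connect_trans (LR a b0) (RL a' b0).
exact: connect_trans (RL a0 b) (LR a0 b').
Qed.

(** * Labels as a periodic predicate of the sum *)

(** Both labels of an edge are decided by this single predicate: an edge has
    label 1 when it holds and label 0 otherwise, because [0] and [-1] are the
    only other values of the Legendre symbol. *)
Definition qres (p k : nat) : bool := legendre k%:Z p == 1%Z.

Lemma legendre_modn p k : legendre (k %% p)%N%:Z p = legendre k%:Z p.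
Proof.
have kp : ((k %% p)%N%:Z = k%:Z %[mod p])%Z by rewrite -modz_nat modz_mod.
rewrite /legendre !dvdzE /= /dvdn modn_mod; case: ifP => // _.
congr (if _ then _ else _); apply: eq_existsb => x; by rewrite kp.
Qed.

Lemma qresDp p k : qres p (k + p) = qres p k.
Proof. by rewrite /qres -legendre_modn modnDr legendre_modn. Qed.

Lemma qresDmulp p n k : qres p (k + n * p) = qres p k.
Proof. by rewrite /qres -legendre_modn addnC modnMDl legendre_modn. Qed.

Lemma induced_labelE p (T : Type) (f : T -> nat) u v :
  induced_label p f u v = qres p (f u + f v).
Proof.
rewrite /induced_label /qres /legendre mod0n dvdzE /= /dvdn.
case: (_ %% p == 0); first by rewrite orbT.
by case: [exists x, _].
Qed.

Lemma rho_edgesE p (G : sgraph) (g : G -> nat) :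
  rho_edges p g = edges_where (fun u v => qres p (g u + g v)).
Proof. by []. Qed.

Lemma eta_edgesE p (G : sgraph) (g : G -> nat) :
  eta_edges p g = edges_where (fun u v => ~~ qres p (g u + g v)).
Proof.
apply: (eq_edges_where (P := fun u v => _ || _)) => u v.
by have := induced_labelE p g u v; rewrite /induced_label; case: ifP; case: qres.
Qed.

Lemma edges_labelledE p (G : sgraph) (f : G -> nat) :
  (edges_labelled p f 0 = edges_where (fun u v => ~~ qres p (f u + f v))) *
  (edges_labelled p f 1 = edges_where (fun u v => qres p (f u + f v))).
Proof.
by split; apply: eq_edges_where => u v; rewrite induced_labelE; case: qres.
Qed.

(** * Counting quadratic residues *)

(** A window of length [p] slid by one step loses [h k] and gains [h (k + p)],
    which are equal; so all windows have the same sum, and [n * p] consecutive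
    terms form [n] windows. *)
Lemma sum_periodic p (h : nat -> nat) : (forall k, h (k + p) = h k) ->
  forall n k, \sum_(0 <= i < n * p) h (i + k) = n * \sum_(0 <= i < p) h i.
Proof.
move=> hp.
have shift k : \sum_(0 <= i < p) h (i + k) = \sum_(0 <= i < p) h i.
  elim: k => [|k IHk]; first by apply: eq_bigr => i _; rewrite addn0.
  apply: (@addnI (h k)); rewrite -[in RHS]IHk.
  (* The longer window [k .. k + p] splits off its first or its last term. *)
  transitivity (\sum_(0 <= i < p.+1) h (i + k)).
    by rewrite big_nat_recl //; congr (_ + _); apply: eq_bigr => i _; rewrite addnS.
  by rewrite big_nat_recr //= addnC [p + k]addnC hp.
elim=> [|n IHn] k; first by rewrite big_nil.
rewrite mulSn (@big_cat_nat _ _ _ p) ?leq_addr //= shift mulSn; congr (_ + _).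
rewrite -{1}[p]add0n [p + _]addnC big_addn addnK -(IHn k).
by apply: eq_bigr => i _; rewrite addnAC hp.
Qed.

Lemma sum_bij_onto_1N (T : finType) N (g : T -> nat) (h : nat -> nat) :
  bij_onto_1N N g -> \sum_(x : T) h (g x) = \sum_(0 <= i < N) h i.+1.
Proof.
move=> [g_inj g_onto].
have -> : \sum_(0 <= i < N) h i.+1 = \sum_(i <- iota 1 N) h i.
  by rewrite (iotaDl 1 0) big_map /index_iota subn0.
rewrite -(big_map g predT h); apply: perm_big; apply: uniq_perm.
- by rewrite map_inj_uniq // index_enum_uniq.
- exact: iota_uniq.
move=> k; rewrite mem_iota add1n ltnS; apply/mapP/idP.
  by case=> x _ ->; apply/g_onto; exists x.
by move/g_onto => [x <-]; exists x; rewrite // mem_index_enum.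
Qed.

(** Squaring is two-to-one on the nonzero elements: the fibre of [x ^+ 2] is
    [{x, - x}], whose two elements differ when [2] is invertible. *)
Lemma card_nonzero_squares (F : finFieldType) : (2%:R != 0 :> F)%R ->
  #|[set (x ^+ 2)%R | x : F & (x != 0)%R]| * 2 = #|F|.-1.
Proof.
move=> two_neq0; rewrite -[#|F|]cardsT (cardsD1 (0%R : F) setT) inE /=.
pose A := [set x : F | x != 0%R].
have -> : [set: F] :\ 0%R = A by apply/setP => x; rewrite !inE andbT.
have -> : [set (x ^+ 2)%R | x : F & (x != 0)%R] = [set (x ^+ 2)%R | x in A].
  by apply/setP => y; apply/imsetP/imsetP => -[x xA ->]; exists x; move: xA;
    rewrite !inE.
rewrite -[RHS]sum1_card (partition_big_imset (fun x : F => x ^+ 2)%R) /=.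
rewrite -sum_nat_const; apply: eq_bigr => y /imsetP[x xA ->]; rewrite inE in xA.
rewrite sum1dep_card (_ : [set _ | _] = [set x; - x]%R).
  rewrite cards2 -addr_eq0 -mulr2n -mulr_natl mulf_eq0 negb_or.
  by rewrite two_neq0 xA.
apply/setP => z; rewrite !inE eqf_sqr; case: (z =P x) => [->|_]; first by rewrite xA.
by case: (z =P _) => [->|_]; rewrite ?andbF // oppr_eq0 xA.
Qed.

(** The residues below [p] are the elements of ['F_p], where [qres] singles out
    the nonzero squares. *)
Lemma sum_qres p : prime p -> odd p -> \sum_(0 <= i < p) qres p i = p./2.
Proof.
move=> p_pr p_odd; have Ep := Fp_cast p_pr.
have two_neq0 : (2%:R != 0 :> 'F_p)%R.
  rewrite -(dvdn_pcharf (pchar_Fp p_pr)) dvdn_prime2 //.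
  by apply: contraL p_odd => /eqP ->.
suff -> : \sum_(0 <= i < p) qres p i
    = #|[set (x ^+ 2)%R | x : 'F_p & (x != 0)%R]|.
  apply: double_inj; rewrite -muln2 card_nonzero_squares // card_Fp //.
  by rewrite -[in LHS](odd_double_half p) p_odd.
(* ['F_p] is a type of ordinals whose bound is only provably equal to [p]. *)
rewrite -[X in \sum_(0 <= i < X) _]Ep big_mkord -sum1_card [RHS]big_mkcond /=.
apply: eq_bigr => x _; set S := imset _ _.
suff -> : qres p x = (x \in S) by case: (x \in S).
have x_lt : x < p by rewrite -[X in _ < X]Ep.
have valF (k : nat) : (k%:R : 'F_p)%R = k %% p :> nat by rewrite val_Fp_nat.
have x_eq0 : (p%:Z %| x%:Z)%Z = (x == 0%R).
  by rewrite dvdzE /= /dvdn modn_small // -val_eqE.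
rewrite /qres /legendre x_eq0; case: (x =P 0%R) => [x0|/eqP x0].
  transitivity false => //; apply/esym/negbTE/imsetP => -[y]; rewrite inE x0 => y0 /esym/eqP.
  by rewrite expf_eq0 (negPf y0).
transitivity [exists i : 'I_p, (Posz i ^+ 2 == Posz x %[mod p])%Z]%R.
  by case: ifP.
have sqE (k : nat) : (Posz k ^+ 2 == Posz x %[mod p])%Z%R = ((k%:R ^+ 2 : 'F_p) == x)%R.
  rewrite !expr2 -PoszM !modz_nat eqz_nat -natrM -val_eqE /= valF.
  by rewrite [x %% p]modn_small.
apply/existsP/imsetP.
  case=> i; rewrite sqE => /eqP ix; exists (i%:R)%R => //.
  by rewrite inE; apply: contra x0 => /eqP i0; rewrite -ix i0 expr0n.
case=> y _ xy; have y_lt : y < p by rewrite -[X in _ < X]Ep.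
by exists (Ordinal y_lt); rewrite sqE /= natr_Zp xy.
Qed.

(** * The labelling of the join *)

Definition join_labelling (G1 G2 : sgraph) (N : nat) (g1 : G1 -> nat)
    (g2 : G2 -> nat) (x : join_graph G1 G2) : nat :=
  match x with inl a => g1 a | inr b => g2 b + N end.

Lemma join_labelling_bij (G1 G2 : sgraph) N m (g1 : G1 -> nat) (g2 : G2 -> nat) :
  bij_onto_1N N g1 -> bij_onto_1N m g2 ->
  bij_onto_1N (N + m) (join_labelling N g1 g2).
Proof.
move=> [inj1 on1] [inj2 on2].
have g1_le a : 1 <= g1 a <= N by apply/on1; exists a.
have g2_le b : 1 <= g2 b <= m by apply/on2; exists b.
split.
  move=> [a|b] [a'|b'] /=.
  - by move/inj1 ->.
  - by have := g1_le a; have := g2_le b'; lia.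
  - by have := g1_le a'; have := g2_le b; lia.
  - by move/addIn/inj2 ->.
move=> k; split=> [k_le|[[a|b] /= <-]].
- case: (leqP k N) => kN.
    have /on1[a <-] : 1 <= k <= N by lia.
    by exists (inl a).
  have /on2[b gb] : 1 <= k - N <= m by lia.
  by exists (inr b); rewrite /= gb; lia.
- by have := g1_le a; lia.
- by have := g2_le b; lia.
Qed.

(** The labels of [g] meet every residue class modulo [p] exactly [n] times, so
    the count cannot depend on the shift [k]; this is why the balance of the
    cross edges at a vertex of the other side does not depend on its label. *)
Lemma sum_qres_shift p n (T : finType) (g : T -> nat) k :
  prime p -> odd p -> bij_onto_1N (n * p) g ->
  \sum_(x : T) qres p (g x + k) = n * p./2.
Proof.
move=> p_pr p_odd g_bij.
rewrite (sum_bij_onto_1N (fun i => nat_of_bool (qres p (i + k))) g_bij).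
rewrite -sum_qres // -(@sum_periodic p (fun i => qres p i) _ n k.+1).
  by apply: eq_bigr => i _; rewrite addSnnS.
by move=> i; rewrite qresDp.
Qed.

Theorem theorem3p3 (p n m : nat) (p_prime : prime p) (p_odd : odd p)
  (n_gt0 : 0 < n) (m_gt0 : 0 < m) (G1 G2 : sgraph)
  (G1_conn : connected_graph G1) (G2_conn : connected_graph G2)
  (G1_order : graph_order G1 = n * p) (G2_order : graph_order G2 = m)
  (g1 : G1 -> nat) (g2 : G2 -> nat)
  (g1_bij : bij_onto_1N (n * p) g1) (g2_bij : bij_onto_1N m g2)
  (balance :
     ((#|rho_edges p g1| + #|rho_edges p g2|)%N%:Z
        = (#|eta_edges p g1| + #|eta_edges p g2| + n * m)%N%:Z + 1 :> int
      \/ (#|rho_edges p g1| + #|rho_edges p g2|)%N%:Z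
        = (#|eta_edges p g1| + #|eta_edges p g2| + n * m)%N%:Z - 1 :> int)%R
     \/ #|rho_edges p g1| + #|rho_edges p g2| = #|eta_edges p g1| + #|eta_edges p g2| + n * m) :
  legendre_cordial_graph p (join_graph G1 G2).
Proof.
split; first by apply: connected_join; [case: G1_conn | case: G2_conn].
pose f := join_labelling (n * p) g1 g2; exists f.
have card1 : #|G1| = n * p by [].
have card2 : #|G2| = m by [].
split.
  by rewrite /graph_order card_sum card1 card2; apply: join_labelling_bij.
(* Each of the [m] vertices of [G2] has [n * p./2] cross edges of label 1. *)
set c := (n * m) * p./2.
have cross1 : \sum_(b : G2) \sum_(a : G1) qres p (f (inl a) + f (inr b)) = c.
  under eq_bigr do rewrite (sum_qres_shift _ p_prime p_odd g1_bij).
  by rewrite sum_nat_const card2 /c; lia.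
have cross0 :
    \sum_(b : G2) \sum_(a : G1) ~~ qres p (f (inl a) + f (inr b)) = c + n * m.
  (* The two kinds together make up [m * (n * p)] pairs, and [p = 2 * p./2 + 1],
     so the complement exceeds [c] by [n * m]. *)
  apply: (@addnI c); rewrite -{1}cross1 -big_split /=.
  under eq_bigr => b _.
    rewrite -big_split /=; under eq_bigr do rewrite addnC addn_negb.
    rewrite sum1_card card1.
    over.
  rewrite sum_nat_const card2 -[in LHS](odd_double_half p) p_odd /c; nia.
have shift2 (a b : G2) :
    qres p (f (inr a) + f (inr b)) = qres p (g2 a + g2 b).
  by rewrite /f /= addnACA -mulnDl qresDmulp.
have e1 : #|edges_labelled p f 1| = #|rho_edges p g1| + #|rho_edges p g2| + c.
  rewrite edges_labelledE card_edges_where_join; last by move=> u v; rewrite addnC.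
  rewrite cross1 !rho_edgesE; congr (_ + #|pred_of_set _| + _).
  by apply: eq_edges_where => a b; rewrite shift2.
have e0 : #|edges_labelled p f 0|
    = #|eta_edges p g1| + #|eta_edges p g2| + (c + n * m).
  rewrite edges_labelledE card_edges_where_join; last by move=> u v; rewrite addnC.
  rewrite cross0 !eta_edgesE; congr (_ + #|pred_of_set _| + _).
  by apply: eq_edges_where => a b; rewrite shift2.
rewrite e0 e1; clear -balance; move: balance.
move: #|rho_edges p g1| #|rho_edges p g2| #|eta_edges p g1| #|eta_edges p g2|.
move: (n * m) c => nm c r1 r2 h1 h2; lia.
Qed.
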